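(* Let $\kappa\in(1/2,1)$, $B>0$, $-B\le\alpha\le 0$, $K\in\mathbb R$, $w_0>0$, $\lambda\ge 0$ and $\eta>0$. Let $Z=Z_T$ be the terminal state-price density. Then the problem $$\min_{M\in L^2(\Omega,\mathcal F_T,\mathbb P),\ 0\le M\le B}\ \mathbb E\Big[-M+\lambda\big(M+\alpha+(1-\kappa)^{-1}(-M-\alpha)^+-K\big)+\eta(ZM-w_0)\Big]$$ is solved by $$M^*=\begin{cases}B, & \text{if } Z\le\frac{1-\lambda}{\eta},\\[2pt] -\alpha, & \text{if } \frac{1-\lambda}{\eta}<Z\le\frac{\lambda((1-\kappa)^{-1}-1)+1}{\eta},\\[2pt] 0, & \text{if } \frac{\lambda((1-\kappa)^{-1}-1)+1}{\eta}<Z.\end{cases}$$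
   Context: Market: on a filtered probability space $(\Omega,\mathcal A,\mathbb P,\mathbb F=(\mathcal F_t)_{0\le t\le T})$ with $\mathbb F$ the completed natural filtration of an $n$-dimensional Brownian motion $W$, there is a risk-free asset $dS^0_t=r_tS^0_t\,dt$ and $n$ risky assets $dS^i_t=S^i_t(\mu^i_t\,dt+\sum_{j}\sigma^{ij}_t\,dW^j_t)$, with positive initial prices. The processes $r,\mu^i,\sigma^{ij}$ are adapted ($r$ predictable) and uniformly bounded, and $\sigma_t\sigma_t^\top\succ\epsilon I$ for all $t\in[0,T]$ a.s., for some constant $\epsilon>0$. Let $b_t=(\mu^1_t-r_t,\dots,\mu^n_t-r_t)^\top$, $\theta_t=\sigma_t^{-1}b_t$. The state-price density is $$Z_t=\exp\Big(-\int_0^t\big(r_s+\tfrac12\|\theta_s\|^2\big)ds-\int_0^t\theta_s^\top dW_s\Big),\qquad Z:=Z_T.$$ Notation: $x^+=\max(x,0)$. *)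

(* Defs.v *)
From HB Require Import structures.
From mathcomp Require Import all_boot all_order all_algebra.
From mathcomp Require Import all_classical all_reals all_analysis.

Set Implicit Arguments.
Unset Strict Implicit.
Unset Printing Implicit Defensive.

Import Order.TTheory GRing.Theory Num.Theory.
Import numFieldNormedType.Exports.

Local Open Scope classical_set_scope.
Local Open Scope ring_scope.

(* Time is the interval [0, T] of R: a process is a function R -> Omega -> _
   of which only the values at times in [0, T] matter. *)

Definition measurable_wrt d (Omega : measurableType d) (R : realType)
    (G : set (set Omega)) (X : Omega -> R) : Prop :=
  measurable_fun [set: g_sigma_algebraType G] (X : g_sigma_algebraType G -> R).

Definition adapted d (Omega : measurableType d) (R : realType) (T : R)
    (F : R -> set (set Omega)) (X : R -> Omega -> R) : Prop :=
  forall t : R, 0 <= t <= T -> measurable_wrt (F t) (X t).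

Definition jointly_measurable d (Omega : measurableType d) (R : realType)
    (T : R) (X : R -> Omega -> R) : Prop :=
  measurable_fun (`[0, T]%classic `*` [set: Omega])
    (fun p : R * Omega => X p.1 p.2).

Definition predictable_rectangle d (Omega : measurableType d) (R : realType)
    (T : R) (F : R -> set (set Omega)) : set (set (R * Omega)) :=
  [set D | (exists2 A, F 0 A & D = [set 0] `*` A) \/
           (exists s t A, [/\ 0 <= s, s < t, t <= T, F s A &
              D = `]s, t]%classic `*` A])].

Definition predictable d (Omega : measurableType d) (R : realType) (T : R)
    (F : R -> set (set Omega)) (X : R -> Omega -> R) : Prop :=
  forall Y : set R, measurable Y ->
    <<s `[0, T]%classic `*` [set: Omega], predictable_rectangle T F >>
      ((`[0, T]%classic `*` [set: Omega]) `&`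
       (fun p : R * Omega => X p.1 p.2) @^-1` Y).

Definition past_events d (Omega : measurableType d) (R : realType) (n : nat)
    (W : R -> Omega -> 'cV[R]_n) (t : R) : set (set Omega) :=
  [set A | exists s (j : 'I_n) (Y : set R),
     [/\ 0 <= s <= t, measurable Y & A = (fun w => W s w j 0) @^-1` Y]].

Definition natural_filtration d (Omega : measurableType d) (R : realType)
    (n : nat) (W : R -> Omega -> 'cV[R]_n) (t : R) : set (set Omega) :=
  <<s past_events W t >>.

(* The null sets added are those of the sigma-algebra of Omega; when P is
   complete these are all the subsets of null sets. *)
Definition completed_natural_filtration d (Omega : measurableType d)
    (R : realType) (P : probability Omega R) (n : nat)
    (W : R -> Omega -> 'cV[R]_n) (t : R) : set (set Omega) :=
  <<s natural_filtration W t `|` [set N | measurable N /\ P N = 0%E] >>.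

(* The second argument of normal_prob is the standard deviation. *)
Record brownian_motion d (Omega : measurableType d) (R : realType)
    (P : probability Omega R) (n : nat) (T : R)
    (W : R -> Omega -> 'cV[R]_n) : Prop := BrownianMotion {
  bm_measurable : forall (t : R) (j : 'I_n), 0 <= t <= T ->
    measurable_fun [set: Omega] (fun w => W t w j 0) ;
  bm_start : {ae P, forall w, W 0 w = 0} ;
  bm_continuous : {ae P, forall w, forall j : 'I_n,
    {within `[0, T]%classic, continuous (fun t : R => W t w j 0)}} ;
  bm_gaussian : forall (s t : R) (j : 'I_n) (Y : set R),
    0 <= s -> s < t -> t <= T -> measurable Y ->
    P [set w | Y (W t w j 0 - W s w j 0)] =
    normal_prob 0 (Num.sqrt (t - s)) Y ;
  bm_independent : forall (s t : R) (E : set Omega) (Y : 'I_n -> set R),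
    0 <= s -> s < t -> t <= T ->
    natural_filtration W s E -> (forall j, measurable (Y j)) ->
    P (E `&` [set w | forall j, Y j (W t w j 0 - W s w j 0)]) =
    (P E * \prod_(j < n) P [set w | Y j (W t w j 0 - W s w j 0)%R])%E
}.

(* The simple process \sum_l xi_l 1_(]t_l, t_(l+1)]]. *)
Record simple_process (Omega : Type) (R : realType) := SimpleProcess {
  sp_size : nat ;
  sp_time : nat -> R ;
  sp_coef : nat -> Omega -> R
}.

Definition simple_admissible d (Omega : measurableType d) (R : realType)
    (T : R) (F : R -> set (set Omega)) (H : simple_process Omega R) : Prop :=
  [/\ 0 <= sp_time H 0,
      forall l, (l < sp_size H)%N -> sp_time H l <= sp_time H l.+1,
      sp_time H (sp_size H) <= T &
      forall l, (l < sp_size H)%N ->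
        measurable_wrt (F (sp_time H l)) (sp_coef H l) /\
        exists C, forall w, `|sp_coef H l w| <= C].

Definition simple_value (Omega : Type) (R : realType)
    (H : simple_process Omega R) (t : R) (w : Omega) : R :=
  \sum_(l < sp_size H)
    sp_coef H l w * \1_(`]sp_time H l, sp_time H l.+1]%classic) t.

Definition simple_integral (Omega : Type) (R : realType)
    (B : R -> Omega -> R) (H : simple_process Omega R) (t : R) (w : Omega) : R :=
  \sum_(l < sp_size H)
    sp_coef H l w *
    (B (Num.min (sp_time H l.+1) t) w - B (Num.min (sp_time H l) t) w).

(* X is a version of the Ito integral of H against B over [0, t]: the limit in
   L^2(Omega, F t, P) of the integrals of simple processes that converge to H
   in L^2([0, t] * Omega, dt * P). *)
Definition is_ito_integral d (Omega : measurableType d) (R : realType)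
    (P : probability Omega R) (T : R) (F : R -> set (set Omega))
    (B : R -> Omega -> R) (H : R -> Omega -> R) (t : R) (X : Omega -> R)
    : Prop :=
  measurable_wrt (F t) X /\
  exists Hk : nat -> simple_process Omega R,
    [/\ forall k, simple_admissible T F (Hk k),
        (fun k => \int[P]_w \int[lebesgue_measure]_(s in `[0%R, t])
           ((simple_value (Hk k) s w - H s w) ^+ 2)%:E)%E @ \oo --> 0%E &
        (fun k => \int[P]_w
           ((simple_integral B (Hk k) t w - X w) ^+ 2)%:E)%E @ \oo --> 0%E].

(* dX_t = a_t dt + \sum_j h^j_t dW^j_t on [0, T]. *)
Definition ito_equation d (Omega : measurableType d) (R : realType)
    (P : probability Omega R) (n : nat) (T : R) (F : R -> set (set Omega))
    (W : R -> Omega -> 'cV[R]_n) (X a : R -> Omega -> R)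
    (h : 'I_n -> R -> Omega -> R) : Prop :=
  [/\ jointly_measurable T X, adapted T F X,
      {ae P, forall w, {within `[0, T]%classic, continuous (fun t : R => X t w)}} &
      forall t : R, 0 <= t <= T ->
        exists J : 'I_n -> Omega -> R,
          (forall j, is_ito_integral P T F (fun s w => W s w j 0) (h j) t (J j))
          /\ {ae P, forall w, X t w =
                X 0 w + \int[lebesgue_measure]_(s in `[0, t]) a s w +
                \sum_(j < n) J j w}].

Definition posdefmx (R : realType) (n : nat) (A : 'M[R]_n) : Prop :=
  forall x : 'cV[R]_n, x != 0 -> 0 < (x^T *m A *m x) 0 0.

Section Market.
Context d (Omega : measurableType d) (R : realType) (P : probability Omega R)
  (n : nat) (T : R) (W : R -> Omega -> 'cV[R]_n)
  (r : R -> Omega -> R) (mu : R -> Omega -> 'cV[R]_n)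
  (sigma : R -> Omega -> 'M[R]_n).

Let F := completed_natural_filtration P W.

(* Measurability in (t, w), which dt-integrals along paths need, is required
   of mu and sigma; for r it follows from predictability. *)
Record market (S0 : R -> Omega -> R) (S : 'I_n -> R -> Omega -> R) : Prop :=
  Market {
  mk_r_predictable : predictable T F r ;
  mk_mu_measurable : forall i, jointly_measurable T (fun t w => mu t w i 0) ;
  mk_mu_adapted : forall i, adapted T F (fun t w => mu t w i 0) ;
  mk_sigma_measurable :
    forall i j, jointly_measurable T (fun t w => sigma t w i j) ;
  mk_sigma_adapted : forall i j, adapted T F (fun t w => sigma t w i j) ;
  mk_bounded : exists C : R, {ae P, forall w, forall t : R, 0 <= t <= T ->
    [/\ `|r t w| <= C, forall i, `|mu t w i 0| <= C &
        forall i j, `|sigma t w i j| <= C]} ;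
  mk_nondegenerate : exists2 eps : R, 0 < eps &
    {ae P, forall w, forall t : R, 0 <= t <= T ->
      posdefmx (sigma t w *m (sigma t w)^T - eps%:M)} ;
  mk_riskfree : ito_equation P T F W S0
    (fun t w => r t w * S0 t w) (fun _ _ _ => 0) ;
  mk_risky : forall i, ito_equation P T F W (S i)
    (fun t w => S i t w * mu t w i 0)
    (fun j t w => S i t w * sigma t w i j) ;
  mk_riskfree_pos : {ae P, forall w, 0 < S0 0 w} ;
  mk_risky_pos : forall i, {ae P, forall w, 0 < S i 0 w}
}.

Definition excess_return (t : R) (w : Omega) : 'cV[R]_n :=
  \col_i (mu t w i 0 - r t w).

Definition market_price_of_risk (t : R) (w : Omega) : 'cV[R]_n :=
  invmx (sigma t w) *m excess_return t w.

(* I j t is the value at time t of the Ito integral of theta^j against W^j. *)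
Definition risk_integrals (I : 'I_n -> R -> Omega -> R) : Prop :=
  forall j t, 0 <= t <= T ->
    is_ito_integral P T F (fun s w => W s w j 0)
      (fun s w => market_price_of_risk s w j 0) t (I j t).

Definition state_price_density (I : 'I_n -> R -> Omega -> R)
    (t : R) (w : Omega) : R :=
  expR (- (\int[lebesgue_measure]_(s in `[0, t])
             (r s w + 2^-1 * \sum_(j < n) market_price_of_risk s w j 0 ^+ 2))
        - \sum_(j < n) I j t w).

End Market.

Definition pos_part (R : realType) (x : R) : R := Num.max x 0.

(* L^2(Omega, G, P) with the constraint 0 <= M <= B almost surely *)
Definition admissible_payoff d (Omega : measurableType d) (R : realType)
    (P : probability Omega R) (G : set (set Omega)) (B : R) (M : Omega -> R)
    : Prop :=
  [/\ measurable_wrt G M, M \in Lfun P 2%:E &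
      {ae P, forall w, 0 <= M w <= B}].

(* Extended-real valued; for Z >= 0 and admissible M the integrand is almost
   surely bounded below, so the expectation is well defined in ]-oo, +oo]. *)
Definition lagrangian d (Omega : measurableType d) (R : realType)
    (P : probability Omega R) (kappa alpha K w0 lambda eta : R)
    (Z M : Omega -> R) : \bar R :=
  ('E_P[(fun w =>
     - M w
     + lambda * (M w + alpha + (1 - kappa)^-1 * pos_part (- M w - alpha) - K)
     + eta * (Z w * M w - w0))%R])%E.

Definition is_minimizer (A : Type) (R : realType) (admissible : A -> Prop)
    (J : A -> \bar R) (x : A) : Prop :=
  admissible x /\ forall y, admissible y -> (J x <= J y)%E.

Definition optimal_payoff (R : realType) (kappa B alpha lambda eta z : R) : R :=
  if z <= (1 - lambda) / eta then B
  else if z <= (lambda * ((1 - kappa)^-1 - 1) + 1) / eta then - alpha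
  else 0.

(* Main.v *)
Require Import Defs.
From HB Require Import structures.
From mathcomp Require Import all_boot all_order all_algebra.
From mathcomp Require Import all_classical all_reals all_analysis.
From mathcomp Require Import measurable_realfun ring lra.

Set Implicit Arguments.
Unset Strict Implicit.
Unset Printing Implicit Defensive.

Import Order.TTheory GRing.Theory Num.Theory.
Import numFieldNormedType.Exports.

Local Open Scope classical_set_scope.
Local Open Scope ring_scope.

(** The integrand of the objective is, for each scenario, a convex piecewise
    affine function of the payoff m with a single kink at -alpha: with
    c = (1 - kappa)^-1 > 0 its slope is eta z - (lambda (c - 1) + 1) on the
    left of the kink and eta z - (1 - lambda) on its right.  The signs of the
    two slopes decide which of B, -alpha and 0 minimizes it over [0, B], and
    this is the case distinction of [optimal_payoff]
    ([optimal_payoff_minimizes]).  Pointwise domination passes to expectations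
    ([ae_le_integral]); that of a competitor may be infinite, so positive and
    negative parts are compared separately.

    What remains is the admissibility of the candidate.  It is bounded, hence
    in L^2, so everything rests on the measurability of Z_T with respect to the
    completed sigma-algebra F_T ([state_price_density_submeasurable]).  The
    stochastic integrals are F_T-measurable by definition.  The time integral
    of r + |theta|^2 / 2 is not immediate: its integrand is measurable in (t, w)
    only for the full sigma-algebra of Omega, while each of its values at a
    fixed time is F_T-measurable, and Fubini yields measurability for the full
    sigma-algebra alone.  The gap is closed in L^2
    ([submeasurable_bounded_integral]).  Let Y be the integral over time of a
    bounded f and Y' the conditional expectation of Y given F_T, which exists by
    Radon-Nikodym ([conditional_expectation_ex]).  Exchanging integrals, and
    conditioning at each time, which is allowed as f_t is F_T-measurable,
      E[Y Y] = int E[f_t Y] dt = int E[f_t Y'] dt = E[Y Y'] = E[Y' Y'],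
    so E[(Y - Y')^2] = 0.  Hence Y = Y' almost surely, and as F_T contains the
    null sets, Y is F_T-measurable.  Truncation and monotone convergence remove
    the boundedness. *)

(** * Conditional expectation *)

(** [measurable_wrt] for an arbitrary target, so as to cover extended-real
    functions. *)
Definition submeasurable d (Omega : measurableType d) d' (V : measurableType d')
    (G : set (set Omega)) (f : Omega -> V) : Prop :=
  measurable_fun [set: g_sigma_algebraType G]
    (f : g_sigma_algebraType G -> V).

Definition is_subalgebra d (Omega : measurableType d) (G : set (set Omega)) :=
  <<s G >> `<=` @measurable d Omega.

Section coarsening.
Local Open Scope ereal_scope.
Context d (Omega : measurableType d) (R : realType) (G : set (set Omega)).
Variables (GA : is_subalgebra G) (m : {finite_measure set Omega -> \bar R}).

Lemma measurable_id_subalgebra :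
  measurable_fun [set: Omega] (id : Omega -> g_sigma_algebraType G).
Proof. by move=> _ Y mY; rewrite setTI; exact: GA. Qed.

(** The restriction of m to the sigma-algebra generated by G, seen as the image
    of m under the identity so that image-measure integrals apply. *)
Definition coarsening of is_subalgebra G :
    set (g_sigma_algebraType G) -> \bar R :=
  pushforward m (id : Omega -> g_sigma_algebraType G).

Local Notation mG := (coarsening GA).

Let mG0 : mG set0 = 0. Proof. exact: (@measure0 _ _ _ m). Qed.
Let mG_ge0 A : 0 <= mG A. Proof. exact: (@measure_ge0 _ _ _ m). Qed.
Let mG_sigma_additive : semi_sigma_additive mG.
Proof.
move=> F mF tF mUF.
by apply: (@measure_semi_sigma_additive _ _ _ m) => // [i|];
  [exact: (GA (mF i))|exact: (GA mUF)].
Qed.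

HB.instance Definition _ :=
  isMeasure.Build _ _ _ mG mG0 mG_ge0 mG_sigma_additive.

Let mG_fin : fin_num_fun mG.
Proof. by move=> A mA; apply: (@fin_num_measure _ _ _ m); exact: GA. Qed.

HB.instance Definition _ := Measure_isFinite.Build _ _ _ mG mG_fin.

Lemma ge0_integral_coarsening (f : Omega -> \bar R) :
  submeasurable G f -> (forall x, 0 <= f x) ->
  \int[mG]_x f x = \int[m]_x f x.
Proof.
move=> mf f0; rewrite ge0_integral_pushforward //.
exact: measurable_id_subalgebra.
Qed.

End coarsening.
Arguments coarsening {d Omega R G} m GA.

Lemma measurable_fun_subalgebra d (Omega : measurableType d)
    (G : set (set Omega)) d' (V : measurableType d') (f : Omega -> V) :
  is_subalgebra G -> submeasurable G f ->
  measurable_fun [set: Omega] f.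
Proof. by move=> GA mf _ Y mY; apply: GA; exact: mf. Qed.

Section density.
Local Open Scope ereal_scope.
Context d (Omega : measurableType d) (R : realType).
Variables (m : {finite_measure set Omega -> \bar R}) (f : Omega -> \bar R).
Hypotheses (f0 : forall x, 0 <= f x) (fi : m.-integrable setT f).

Lemma induced_charge_ge0 E : 0 <= induced_charge fi E.
Proof. exact: integral_ge0. Qed.

Definition density_measure :=
  measure_of_charge (induced_charge fi) induced_charge_ge0.

HB.instance Definition _ := Measure.on density_measure.

Let density_measure_fin : fin_num_fun density_measure.
Proof. by move=> A mA; apply: (@fin_num_measure _ _ _ (induced_charge fi)). Qed.

HB.instance Definition _ :=
  Measure_isFinite.Build _ _ _ density_measure density_measure_fin.

Lemma density_measure_dominates : density_measure `<< m.
Proof.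
apply/null_content_dominatesP => A mA mA0.
rewrite /density_measure /measure_of_charge /induced_charge.
apply: null_set_integral => //.
exact: measurable_funTS (measurable_int _ fi).
Qed.

(** The Radon-Nikodym derivative of the measure with density f is f itself,
    so the formula is an instance of change of variables. *)
Lemma ge0_integral_density (g : Omega -> \bar R) :
  measurable_fun setT g -> (forall x, 0 <= g x) ->
  \int[density_measure]_x g x = \int[m]_x (g x * f x).
Proof.
move=> mg g0; have dom := density_measure_dominates.
rewrite -(Radon_Nikodym_SigmaFinite.change_of_variables dom)//.
have hi := Radon_Nikodym_SigmaFinite.f_integrable dom.
have mf := measurable_int _ fi.
apply: ae_eq_integral => //.
- by apply: emeasurable_funM => //; exact: measurable_int hi.
- exact: emeasurable_funM.
- suff : ae_eq m setT (Radon_Nikodym_SigmaFinite.f density_measure m) f.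
    by apply: filterS => w fw _; rewrite fw.
  apply: integral_ae_eq => // E _ mE.
  by rewrite -Radon_Nikodym_SigmaFinite.f_integral.
Qed.

End density.

Section conditional_expectation.
Local Open Scope ereal_scope.

(** Y' is the Radon-Nikodym derivative, on the smaller sigma-algebra, of the
    measure with density Y.  The defining property is stated against functions
    rather than events, the form in which it is used under an integral sign. *)
Lemma conditional_expectation_ex d (Omega : measurableType d) (R : realType)
    (m : {finite_measure set Omega -> \bar R}) (G : set (set Omega))
    (Y : Omega -> \bar R) :
  is_subalgebra G -> (forall w, 0 <= Y w) -> m.-integrable setT Y ->
  exists Y' : Omega -> \bar R,
    [/\ submeasurable G Y',
        forall w, 0 <= Y' w, forall w, Y' w \is a fin_num &
        forall X : Omega -> \bar R,
          submeasurable G X -> (forall w, 0 <= X w) ->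
          \int[m]_w (X w * Y w) = \int[m]_w (X w * Y' w)].
Proof.
move=> GA Y0 iY.
have mY := measurable_int _ iY.
pose nu : {finite_measure set (g_sigma_algebraType G) -> \bar R} :=
  coarsening (density_measure Y0 iY) GA.
pose mG : {finite_measure set (g_sigma_algebraType G) -> \bar R} :=
  coarsening m GA.
have dom : nu `<< mG.
  apply/null_content_dominatesP => A mA mA0.
  have /null_content_dominatesP := density_measure_dominates Y0 iY.
  by apply => //; exact: (GA A mA).
exists (Radon_Nikodym_SigmaFinite.f nu mG); split.
- exact: measurable_int (Radon_Nikodym_SigmaFinite.f_integrable dom).
- exact: (Radon_Nikodym_SigmaFinite.f_ge0 dom).
- exact: (Radon_Nikodym_SigmaFinite.f_fin_num dom).
move=> X mX X0.
rewrite -(ge0_integral_density Y0 iY) //; last first.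
  exact: (measurable_fun_subalgebra GA mX).
transitivity (\int[nu]_w X w); first by rewrite ge0_integral_coarsening.
have := Radon_Nikodym_SigmaFinite.change_of_variables dom X0 measurableT mX.
move=> /esym ->.
rewrite ge0_integral_coarsening// => [|w].
  apply: emeasurable_funM => //.
  exact: measurable_int (Radon_Nikodym_SigmaFinite.f_integrable dom).
by rewrite mule_ge0//; exact: (Radon_Nikodym_SigmaFinite.f_ge0 dom).
Qed.

End conditional_expectation.

(** * Integrals over time of processes measurable at each time *)

Section integral_of_adapted_bounded.
Local Open Scope ereal_scope.

Definition contains_null_sets d (Omega : measurableType d) (R : realType)
    (m : set Omega -> \bar R) (G : set (set Omega)) :=
  forall N, measurable N -> m N = 0 -> <<s G >> N.

(** The preimages under f and g differ by a null set only. *)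
Lemma submeasurable_ae_eq d (Omega : measurableType d) (R : realType)
    (m : {measure set Omega -> \bar R}) (G : set (set Omega))
    d' (V : measurableType d') (f g : Omega -> V) :
  is_subalgebra G -> contains_null_sets m G ->
  measurable_fun setT f -> submeasurable G g -> ae_eq m setT f g ->
  submeasurable G f.
Proof.
move=> GA GN mf mg [N [mN mN0 fgN]] _ B mB.
have fgE w : ~ N w -> f w = g w.
  by move=> Nw; apply: contrapT => fg; apply/Nw/fgN => /= /(_ I).
have -> : [set: g_sigma_algebraType G] `&` f @^-1` B =
    ((g @^-1` B) `\` N) `|` (f @^-1` B `&` N).
  rewrite setTI; apply/seteqP; split=> w /=.
    by have [Nw|Nw] := pselect (N w); [right|left; rewrite -fgE].
  by move=> [[gB /fgE ->]|[]].
have mGN A : measurable A -> m A = 0 ->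
    measurable (A : set (g_sigma_algebraType G)) by exact: GN.
have mfB : measurable (f @^-1` B).
  by rewrite -[X in measurable X]setTI; exact: mf.
apply: measurableU.
  apply: measurableD; last exact: mGN.
  by rewrite -[X in measurable X]setTI; exact: mg.
apply: mGN; first exact: measurableI.
by apply: (subset_measure0 _ mN) => //; exact: measurableI.
Qed.

(** Fubini gives measurability of the integral for the full sigma-algebra only.
    The integral Y is compared with its conditional expectation Y' given G:
    every section of f being G-measurable, E[Y Y] = E[Y Y'], and then
    E[(Y - Y')^2] = 0. *)
Lemma submeasurable_bounded_integral d (Omega : measurableType d) (R : realType)
    (m : {finite_measure set Omega -> \bar R}) (G : set (set Omega))
    d1 (T1 : measurableType d1) (mu : {sigma_finite_measure set T1 -> \bar R})
    (f : T1 * Omega -> \bar R) (C : R) :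
  is_subalgebra G -> contains_null_sets m G ->
  measurable_fun setT f -> (forall p, 0 <= f p) ->
  (forall t, submeasurable G (fun w => f (t, w))) ->
  (forall w, \int[mu]_t f (t, w) <= C%:E) ->
  submeasurable G (fun w => \int[mu]_t f (t, w)).
Proof.
move=> GA GN mf f0 fG YC; set Y := fun w => _.
have mY : measurable_fun setT Y by exact: measurable_fun_fubini_tonelli_G.
have Y0 w : 0 <= Y w by apply: integral_ge0.
have Yfin w : Y w \is a fin_num.
  by rewrite ge0_fin_numE// (le_lt_trans (YC w))// ltry.
have iY : m.-integrable setT Y.
  apply: (le_integrable measurableT mY _
    (finite_measure_integrable_cst m C measurableT)) => w _ /=.
  rewrite gee0_abs// (le_trans (YC w))// lee_fin ler_norm//.
have [Y' [mY' Y'0 Y'fin Y'E]] := conditional_expectation_ex GA Y0 iY.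
have mY'A := measurable_fun_subalgebra GA mY'.
have fubini V : measurable_fun setT V -> (forall w, 0 <= V w) ->
    \int[m]_w (Y w * V w) = \int[mu]_t \int[m]_w (f (t, w) * V w).
  move=> mV V0.
  transitivity (\int[m]_w \int[mu]_t (f (t, w) * V w)).
    apply: eq_integral => w _; rewrite ge0_integralZr//.
    exact: (measurableT_comp mf).
  rewrite -(fubini_tonelli (m1 := mu) (m2 := m)
    (fun p => f p * V p.2))// => [|p].
    by apply: emeasurable_funM => //; exact: measurableT_comp.
  by rewrite mule_ge0.
(* Each section of f may be used as a test function of Y'. *)
have YY : \int[m]_w (Y w * Y w) = \int[m]_w (Y w * Y' w).
  rewrite !fubini//; apply: eq_integral => t _.
  by apply: Y'E => //; exact: fG.
have YY' : \int[m]_w (Y w * Y' w) = \int[m]_w (Y' w * Y' w).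
  by rewrite -(Y'E Y')//; apply: eq_integral => w _; rewrite muleC.
have YYfin : \int[m]_w (Y w * Y' w) \is a fin_num.
  rewrite -YY ge0_fin_numE; last first.
    by apply: integral_ge0 => w _; rewrite mule_ge0.
  apply: (@le_lt_trans _ _ (\int[m]_w (C * C)%:E)).
    apply: ge0_le_integral => //.
    - by move=> w _; rewrite mule_ge0.
    - exact: emeasurable_funM.
    - by move=> w _; rewrite EFinM; apply: lee_pmul => //; exact: YC.
  rewrite integral_cst// -ge0_fin_numE ?fin_numM ?fin_num_measure//.
  by rewrite mule_ge0// lee_fin -expr2 sqr_ge0.
pose s w : R := ((fine (Y w) - fine (Y' w)) ^+ 2)%R.
have ms : measurable_fun setT (EFin \o s).
  apply/measurable_EFinP; apply: measurable_funX; apply: measurable_funB.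
    exact: measurableT_comp.
  exact: measurableT_comp.
have s0 w : 0 <= (s w)%:E by rewrite lee_fin sqr_ge0.
(* The square is expanded with all terms nonnegative, as the extended-real
   additivity of the integral requires. *)
have sE w : (s w)%:E + (Y w * Y' w + Y w * Y' w) = Y w * Y w + Y' w * Y' w.
  rewrite -(fineK (Yfin w)) -(fineK (Y'fin w)) -!EFinM -!EFinD; congr EFin.
  by rewrite /s /=; ring.
have int_s : \int[m]_w (s w)%:E = 0.
  have : \int[m]_w ((s w)%:E + (Y w * Y' w + Y w * Y' w)) =
         \int[m]_w (Y w * Y w + Y' w * Y' w) by apply: eq_integral.
  have mYY' : measurable_fun setT (fun w => Y w * Y' w).
    exact: emeasurable_funM.
  have YY'0 w : 0 <= Y w * Y' w by rewrite mule_ge0.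
  rewrite ge0_integralD//; last 2 first.
  - by move=> w _; rewrite adde_ge0.
  - exact: emeasurable_funD.
  rewrite ge0_integralD// ge0_integralD//; last 4 first.
  - by move=> w _; rewrite mule_ge0.
  - exact: emeasurable_funM.
  - by move=> w _; rewrite mule_ge0.
  - exact: emeasurable_funM.
  rewrite YY -YY' => sE0.
  have cfin : \int[m]_w (Y w * Y' w) + \int[m]_w (Y w * Y' w) \is a fin_num.
    by rewrite fin_numD YYfin.
  by rewrite -[LHS](addeK _ cfin) sE0 subee.
apply: (submeasurable_ae_eq GA GN mY mY').
have /(ae_eq_integral_abs m measurableT ms)  : \int[m]_w `|(EFin \o s) w| = 0.
  by rewrite -[RHS]int_s; apply: eq_integral => w _; exact: (gee0_abs (s0 w)).
apply: filterS => w /(_ I) [] /eqP; rewrite sqrf_eq0 subr_eq0 => /eqP YY'w _.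
by rewrite -(fineK (Yfin w)) YY'w fineK.
Qed.

End integral_of_adapted_bounded.

Section adapted_integral.
Local Open Scope ereal_scope.
Context d (Omega : measurableType d) (R : realType)
  (m : {finite_measure set Omega -> \bar R}) (G : set (set Omega)).
Hypotheses (GA : is_subalgebra G) (GN : contains_null_sets m G).
Context d1 (T1 : measurableType d1)
  (mu : {sigma_finite_measure set T1 -> \bar R}) (D : set T1).
Hypotheses (mD : measurable D) (muD : mu D < +oo).

(** The truncations min(f, n) fall under the bounded case, and their integrals
    increase to the integral of f. *)
Lemma submeasurable_ge0_integral (f : T1 * Omega -> R) :
  measurable_fun (D `*` setT) f -> (forall p, (0 <= f p)%R) ->
  (forall t, D t -> submeasurable G (fun w => f (t, w))) ->
  submeasurable G (fun w => \int[mu]_(t in D) (f (t, w))%:E).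
Proof.
move=> mf f0 fG.
pose g (n : nat) t w := Num.min (f (t, w)) n%:R.
have g0 n t w : (0 <= g n t w)%R by rewrite le_min f0 ler0n.
have mfw w : measurable_fun D (fun t => f (t, w)).
  apply: (measurable_comp (F := D `*` setT)) mf _ => //.
  - exact: measurableX.
  - by move=> _ [t Dt <-].
  - exact: measurable_funTS.
have mg n w : measurable_fun D (fun t => (g n t w)%:E).
  by apply/measurable_EFinP; exact: measurable_minr.
suff gG n : submeasurable G (fun w => \int[mu]_(t in D) (g n t w)%:E).
  apply: (emeasurable_fun_cvg _ _ gG) => w _.
  have fE : \int[mu]_(t in D) (f (t, w))%:E =
      \int[mu]_(t in D) limn (fun n => (g n t w)%:E).
    apply: eq_integral => t _; apply/esym/cvg_lim => //.
    apply: cvg_near_cst; near=> n; congr EFin; apply/min_idPl.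
    by near: n; exact: nbhs_infty_ger.
  rewrite fE; apply: cvg_monotone_convergence => //.
  - by move=> n t Dt; rewrite lee_fin.
  - move=> t Dt p q pq; rewrite lee_fin /g le_min ge_min lexx/= ge_min.
    by rewrite ler_nat pq orbT.
(* Extended by 0 off D, the truncated function is bounded with integral over
   the whole of T1 at most n mu(D). *)
pose h := (fun p : T1 * Omega => (g n p.1 p.2)%:E) \_ (D `*` [set: Omega]).
have hE t w : h (t, w) = ((fun t => (g n t w)%:E) \_ D) t.
  rewrite /h !patchE; congr (if _ then _ else _).
  by apply/idP/idP; rewrite !inE => // -[].
rewrite (_ : (fun w => _) = (fun w => \int[mu]_t h (t, w))); last first.
  apply/funext => w; rewrite integral_mkcond; apply: eq_integral => t _.
  by rewrite hE.
apply: (submeasurable_bounded_integral (m := m) (f := h)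
  (C := fine (n%:R%:E * mu D))) => //.
- apply/(measurable_restrictT _ _).1; first exact: measurableX.
  apply/measurable_EFinP.
  apply: measurable_minr => //.
  by apply: eq_measurable_fun mf => -[].
- by move=> p; apply: erestrict_ge0 => q _; rewrite lee_fin.
- move=> t; have [Dt|Dt] := pselect (D t).
    rewrite (_ : (fun w => h (t, w)) = (fun w => (g n t w)%:E)); last first.
      by apply/funext => w; rewrite hE patchE mem_set.
    by apply/measurable_EFinP; apply: measurable_minr => //; exact: fG.
  rewrite (_ : (fun w => h (t, w)) = cst 0); first exact: measurable_cst.
  by apply/funext => w; rewrite hE patchE memNset.
- move=> w; rewrite fineK; last first.
    by rewrite fin_numM// ge0_fin_numE.
  rewrite -(integral_cst mu mD).
  have -> : \int[mu]_t h (t, w) = \int[mu]_(t in D) (g n t w)%:E.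
    by rewrite [RHS]integral_mkcond; apply: eq_integral => t _; rewrite hE.
  apply: ge0_le_integral => //.
  + by move=> t _; rewrite lee_fin.
  + by move=> t _; rewrite lee_fin ge_min lexx orbT.
Unshelve. all: by end_near. Qed.

Lemma submeasurable_Rintegral (f : T1 * Omega -> R) :
  measurable_fun (D `*` setT) f ->
  (forall t, D t -> submeasurable G (fun w => f (t, w))) ->
  submeasurable G (fun w => \int[mu]_(t in D) f (t, w))%R.
Proof.
move=> mf fG.
rewrite (_ : (fun w => _) = (fun w => fine
  (\int[mu]_(t in D) (Num.max (f (t, w)) 0)%:E -
   \int[mu]_(t in D) (Num.max (- f (t, w)) 0)%:E))); last first.
  apply/funext => w; rewrite /Rintegral integralE; congr (fine (_ - _)).
    by apply: eq_integral => t _; rewrite funeposE -EFin_max.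
  by apply: eq_integral => t _; rewrite funenegE -EFin_max.
apply: measurableT_comp => //; apply: emeasurable_funB.
  apply: (submeasurable_ge0_integral (f := fun p => Num.max (f p) 0%R)).
  - exact: measurable_maxr.
  - by move=> p; rewrite le_max lexx orbT.
  - by move=> t Dt; apply: measurable_maxr => //; exact: fG.
apply: (submeasurable_ge0_integral (f := fun p => Num.max (- f p) 0)%R).
- by apply: measurable_maxr => //; exact: measurableT_comp.
- by move=> p; rewrite le_max lexx orbT.
- move=> t Dt; apply: measurable_maxr => //; apply: measurableT_comp => //.
  exact: fG.
Qed.

End adapted_integral.

(** * Measurability of the market price of risk *)

Lemma measurable_invr (R : realType) : measurable_fun [set: R] (@GRing.inv R).
Proof.
rewrite (_ : GRing.inv = fun x : R => if x == 0 then 0 else x^-1); last first.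
  by apply/funext => x; case: eqVneq => // ->; rewrite invr0.
(* The inverse is continuous off 0, and the default value 0^-1 = 0 is isolated
   by the test. *)
apply: measurable_fun_if => //.
  exact: measurable_fun_eqr.
rewrite setTI (_ : _ @^-1` _ = [set~ 0]); last first.
  by apply/seteqP; split => x /=; [move/negbT/eqP|move/eqP/negbTE].
apply: open_continuous_measurable_fun.
  exact: (closed_openC (@closed_eq R 0)).
by move=> x; rewrite inE => /eqP; exact: inv_continuous.
Qed.

Section measurable_matrix.
Context d (U : measurableType d) (R : realType) (D : set U).
Hypothesis mD : measurable D.

Lemma measurable_det n (A : U -> 'M[R]_n) :
  (forall i j, measurable_fun D (fun u => A u i j)) ->
  measurable_fun D (fun u => \det (A u)).
Proof.
move=> mA; apply: measurable_sum => s; apply: measurable_funM => //.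
exact: measurable_prod.
Qed.

Lemma measurable_invmx n (A : U -> 'M[R]_n) :
  (forall i j, measurable_fun D (fun u => A u i j)) ->
  forall i j, measurable_fun D (fun u => invmx (A u) i j).
Proof.
move=> mA i j.
have mdet := measurable_det mA.
(* [invmx] is the identity on singular matrices. *)
rewrite (_ : (fun u => _) = fun u => if \det (A u) == 0 then A u i j
   else (\det (A u))^-1 * cofactor (A u) j i); last first.
  apply/funext => u; rewrite /invmx unitmxE unitfE.
  by case: eqVneq => //= _; rewrite !mxE.
apply: measurable_fun_if => //.
- exact: measurable_fun_eqr.
- exact: measurable_funS (mA i j).
apply: (measurable_funS mD) => //; apply: measurable_funM.
  exact: (measurableT_comp (@measurable_invr R)).
apply: measurable_funM => //; apply: measurable_det => k l.
rewrite (_ : (fun u => _) = (fun u => A u (lift j k) (lift i l))) //.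
by apply/funext => u; rewrite !mxE.
Qed.

(** Stated on an arbitrary space so as to apply both on [0, T] * Omega and, at a
    fixed time, on Omega with the sigma-algebra F_T. *)
Lemma measurable_risk_rate n (r : U -> R) (mu : U -> 'cV[R]_n)
    (sigma : U -> 'M[R]_n) :
  measurable_fun D r -> (forall i, measurable_fun D (fun u => mu u i 0)) ->
  (forall i j, measurable_fun D (fun u => sigma u i j)) ->
  measurable_fun D (fun u => r u + 2^-1 *
    \sum_(j < n) (invmx (sigma u) *m \col_i (mu u i 0 - r u)) j 0 ^+ 2).
Proof.
move=> mr mmu msigma; apply: measurable_funD => //.
apply: measurable_funM => //; apply: measurable_sum => j.
apply: measurable_funX.
rewrite (_ : (fun u => _) =
  (fun u => \sum_k invmx (sigma u) j k * (mu u k 0 - r u))); last first.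
  by apply/funext => u; rewrite mxE; apply: eq_bigr => k _; rewrite mxE.
apply: measurable_sum => k; apply: measurable_funM.
  exact: measurable_invmx.
exact: measurable_funB.
Qed.

End measurable_matrix.

(** * The completed filtration and predictable processes *)

Lemma submeasurable_sub d (Omega : measurableType d) (G G' : set (set Omega))
    d' (V : measurableType d') (f : Omega -> V) :
  G `<=` <<s G' >> -> submeasurable G f -> submeasurable G' f.
Proof.
move=> GG' mf _ Y mY.
have : <<s G >> `<=` <<s G' >>.
  by apply: smallest_sub => //; exact: smallest_sigma_algebra.
by apply; exact: mf.
Qed.

Section filtration.
Context d (Omega : measurableType d) (R : realType) (P : probability Omega R)
  (n : nat) (T : R) (W : R -> Omega -> 'cV[R]_n).

Local Notation F := (completed_natural_filtration P W).

Lemma completed_filtration_nd s t : s <= t -> F s `<=` F t.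
Proof.
move=> st; apply: sub_smallest2r; first exact: smallest_sigma_algebra.
apply: setSU; apply: sub_smallest2r; first exact: smallest_sigma_algebra.
move=> A [u [j [Y [/andP[u0 us] mY ->]]]]; exists u, j, Y; split => //.
by rewrite u0 (le_trans us).
Qed.

Lemma completed_filtration_contains_null_sets t : contains_null_sets P (F t).
Proof.
move=> N mN PN0; apply: sub_gen_smallest; apply: sub_gen_smallest.
by right.
Qed.

Lemma completed_filtration_subalgebra :
  (forall (t : R) (j : 'I_n), 0 <= t <= T ->
    measurable_fun [set: Omega] (fun w => W t w j 0)) ->
  forall t, t <= T -> is_subalgebra (F t).
Proof.
move=> mW t tT.
have sa : sigma_algebra setT (@measurable d Omega).
  split; first exact: measurable0.
    by move=> A mA; exact: measurableD.
  by move=> A mA; exact: bigcup_measurable.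
apply: smallest_sub => //; apply: smallest_sub => // A [|[]//].
move: A; apply: smallest_sub => // A [u [j [Y [/andP[u0 ut] mY ->]]]].
rewrite -[X in measurable X]setTI; apply: mW => //.
by rewrite u0 (le_trans ut).
Qed.

End filtration.

Section predictable.
Context d (Omega : measurableType d) (R : realType) (T : R)
  (F : R -> set (set Omega)).
Hypotheses (T0 : 0 <= T) (FA : is_subalgebra (F T))
  (Fnd : forall t, t <= T -> F t `<=` F T).

Let good (A : set (R * Omega)) := [/\ A `<=` `[0, T]%classic `*` setT,
  measurable A & forall t, <<s F T >> [set w | A (t, w)]].

(** The sets with both properties form a sigma-algebra of subsets of
    [0, T] * Omega that contains the rectangles. *)
Lemma predictable_sets_measurable A :
  <<s `[0, T]%classic `*` [set: Omega], predictable_rectangle T F >> A ->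
  measurable A /\ forall t, <<s F T >> [set w | A (t, w)].
Proof.
have FTA B t : t <= T -> F t B -> <<s F T >> B.
  by move=> tT /(Fnd tT) FB; exact: sub_gen_smallest.
have mrect B (I : set R) : measurable I -> <<s F T >> B ->
    measurable (I `*` B) /\ forall t, <<s F T >> [set w | (I `*` B) (t, w)].
  move=> mI FB; split; first by apply: measurableX => //; exact: FA.
  move=> t; have [It|It] := pselect (I t).
    by rewrite (_ : [set w | _] = B) //; apply/seteqP; split => w //= [].
  rewrite (_ : [set w | _] = set0); first exact: sigma_algebra0.
  by apply/seteqP; split => w //= [].
suff : <<s `[0, T]%classic `*` [set: Omega], predictable_rectangle T F >>
    `<=` good.
  by move=> /(_ A)/[apply] -[].
have mD : measurable (`[0, T]%classic `*` [set: Omega]) by exact: measurableX.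
apply: smallest_sub; first split.
- split => // t; exact: sigma_algebra0.
- move=> B [BD mB FB]; split => [p []//||t].
  + exact: measurableD.
  + have [t0T|t0T] := pselect (`[0, T]%classic t).
      rewrite (_ : [set w | _] = ~` [set w | B (t, w)]).
        exact: (sigma_algebraC (FB t)).
      by apply/seteqP; split => w //= [].
    rewrite (_ : [set w | _] = set0); first exact: sigma_algebra0.
    by apply/seteqP; split => w //= [] [].
- move=> B gB; split => [p [k _] Bp||t].
  + by have [BD _ _] := gB k; exact: BD.
  + by apply: bigcup_measurable => k _; have [] := gB k.
  + rewrite (_ : [set w | _] = \bigcup_k [set w | B k (t, w)])//.
    apply: (@bigcupT_measurable _ (g_sigma_algebraType (F T))) => k.
    by have [_ _ /(_ t)] := gB k.
- move=> B [[C FC ->]|[s [t [C [s0 st tT FC ->]]]]].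
  + have [mB FB] := mrect C [set 0] (measurable_set1 _) (FTA _ _ T0 FC).
    by split => // -[t w] [/= -> _]; split => //=; rewrite in_itv/= lexx.
  + have sT : s <= T by rewrite ltW// (lt_le_trans st).
    have [mB FB] := mrect C `]s, t]%classic (measurable_itv _) (FTA _ _ sT FC).
    split => // -[u w] [/=]; rewrite in_itv/= => /andP[su ut] _; split => //=.
    by rewrite in_itv/= (le_trans ut)// (le_trans s0)// ltW.
Qed.

Lemma predictable_jointly_measurable X :
  predictable T F X -> jointly_measurable T X.
Proof.
by move=> pX _ Y mY; have [] := predictable_sets_measurable (pX Y mY).
Qed.

Lemma predictable_submeasurable X t : predictable T F X -> 0 <= t <= T ->
  submeasurable (F T) (X t).
Proof.
move=> pX t0T _ Y mY; have [_ /(_ t)] := predictable_sets_measurable (pX Y mY).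
rewrite setTI; congr (<<s F T >> _); apply/seteqP; split => w /=; first by case.
by split => //; split => //=; rewrite in_itv.
Qed.

End predictable.

(** * Measurability of the state-price density *)

Section state_price_density_measurable.
Context d (Omega : measurableType d) (R : realType) (P : probability Omega R)
  (n : nat) (T : R) (W : R -> Omega -> 'cV[R]_n)
  (r : R -> Omega -> R) (mu : R -> Omega -> 'cV[R]_n)
  (sigma : R -> Omega -> 'M[R]_n) (I : 'I_n -> R -> Omega -> R).

Local Notation F := (completed_natural_filtration P W).

(** The time integral is covered by [submeasurable_Rintegral], the stochastic
    integrals by their definition as F_T-measurable limits. *)
Lemma state_price_density_submeasurable :
  0 <= T -> brownian_motion P T W ->
  predictable T F r ->
  (forall i, jointly_measurable T (fun t w => mu t w i 0)) ->
  (forall i, adapted T F (fun t w => mu t w i 0)) ->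
  (forall i j, jointly_measurable T (fun t w => sigma t w i j)) ->
  (forall i j, adapted T F (fun t w => sigma t w i j)) ->
  risk_integrals P T W r mu sigma I ->
  submeasurable (F T) (state_price_density r mu sigma I T).
Proof.
move=> T0 bm r_pred mu_meas mu_ad sigma_meas sigma_ad I_ito.
have FA : is_subalgebra (F T).
  exact: (completed_filtration_subalgebra (bm_measurable bm)).
have Fnd t : t <= T -> F t `<=` F T by exact: completed_filtration_nd.
have lift V : adapted T F V ->
    forall t, 0 <= t <= T -> submeasurable (F T) (V t).
  move=> adV t t0T; apply: (submeasurable_sub _ (adV t t0T)).
  apply: (subset_trans (Fnd t _)); last exact: sub_gen_smallest.
  by case/andP: t0T.
have mD : measurable (`[0, T]%classic `*` [set: Omega]) by exact: measurableX.
apply: (measurableT_comp (@measurable_expR R)).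
apply: measurable_funB; last first.
  apply: measurable_sum => j.
  by have [] := I_ito j T; rewrite ?T0 ?lexx.
apply: measurable_funN.
have leb_fin : (lebesgue_measure `[0%R, T]%classic < +oo)%E.
  by rewrite lebesgue_measure_itv/=; case: ifP => // _; rewrite -EFinD ltry.
have FN : contains_null_sets P (F T).
  exact: completed_filtration_contains_null_sets.
apply: (submeasurable_Rintegral FA FN (mu := lebesgue_measure)
  (measurable_itv `[0, T]) leb_fin
  (f := fun p => r p.1 p.2 + 2^-1 *
    \sum_(j < n) market_price_of_risk r mu sigma p.1 p.2 j 0 ^+ 2)) => //.
- apply: (measurable_risk_rate mD) => //.
  exact: (predictable_jointly_measurable T0 FA Fnd).
- move=> t /=; rewrite in_itv/= => t0T.
  apply: (measurable_risk_rate (U := g_sigma_algebraType (F T))) => //.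
  + exact: (predictable_submeasurable T0 FA Fnd).
  + by move=> i; exact: (lift (fun t w => mu t w i 0)).
  + by move=> i j; exact: (lift (fun t w => sigma t w i j)).
Qed.

End state_price_density_measurable.

(** * Minimization of the Lagrangian *)

Section optimal_payoff.
Context (R : realType) (kappa B alpha K w0 lambda eta : R).
Hypotheses (kappa_lt : kappa < 1) (B_gt0 : 0 < B) (alpha_ge : - B <= alpha)
  (alpha_le : alpha <= 0) (lambda_ge0 : 0 <= lambda) (eta_gt0 : 0 < eta).

Local Notation opt := (optimal_payoff kappa B alpha lambda eta).

Definition lagrangian_integrand (z m : R) : R :=
  - m + lambda * (m + alpha + (1 - kappa)^-1 * pos_part (- m - alpha) - K)
  + eta * (z * m - w0).

Lemma optimal_payoff_itv z : 0 <= opt z <= B.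
Proof.
rewrite /optimal_payoff; case: ifP => _; first by rewrite ltW/=.
by case: ifP => _; rewrite ?lexx ?(ltW B_gt0)// oppr_ge0 alpha_le lerNl.
Qed.

(** The gap between the values at m and at the optimum is a one-sided slope
    times a displacement of the favourable sign, plus lambda c times one of the
    nonnegative quantities p and p - (- m - alpha). *)
Lemma optimal_payoff_minimizes z m : 0 <= m <= B ->
  lagrangian_integrand z (opt z) <= lagrangian_integrand z m.
Proof.
move=> /andP[m0 mB]; rewrite /lagrangian_integrand /optimal_payoff.
set c := (1 - kappa)^-1.
have c0 : 0 <= c by rewrite invr_ge0 subr_ge0 ltW.
have lc0 : 0 <= lambda * c by rewrite mulr_ge0.
rewrite !ler_pdivlMr// [z * eta]mulrC.
set p := pos_part (- m - alpha).
have p0 : 0 <= p by rewrite le_max lexx orbT.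
have pm : - m - alpha <= p by rewrite le_max lexx.
have lcp : 0 <= lambda * c * p by rewrite mulr_ge0.
have [s1|s1] := leP (eta * z) (1 - lambda).
  have -> : pos_part (- B - alpha) = 0 by apply/max_idPr; rewrite subr_le0.
  have : 0 <= (1 - lambda - eta * z) * (B - m) by rewrite mulr_ge0// subr_ge0.
  nra.
have [s2|s2] := leP (eta * z) (lambda * (c - 1) + 1).
  rewrite opprK addrC subrr /pos_part maxxx.
  have [ma|ma] := leP (- alpha) m.
    have : 0 <= (eta * z - (1 - lambda)) * (m + alpha).
      by apply: mulr_ge0; lra.
    nra.
  have : 0 <= (lambda * (c - 1) + 1 - eta * z) * (- alpha - m).
    by apply: mulr_ge0; lra.
  have : 0 <= lambda * c * (p - (- m - alpha)) by rewrite mulr_ge0 ?subr_ge0.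
  nra.
have -> : pos_part (- 0 - alpha) = - alpha.
  by rewrite oppr0 sub0r; apply/max_idPl; rewrite oppr_ge0.
have : 0 <= (eta * z - (lambda * (c - 1) + 1)) * m.
  by apply: mulr_ge0; lra.
have : 0 <= lambda * c * (p - (- m - alpha)) by rewrite mulr_ge0 ?subr_ge0.
nra.
Qed.

Lemma measurable_optimal_payoff : measurable_fun [set: R] opt.
Proof.
apply: measurable_fun_ifT => //; first exact: measurable_fun_ler.
apply: measurable_fun_ifT => //; exact: measurable_fun_ler.
Qed.

End optimal_payoff.

(** Positive and negative parts are compared separately, which covers infinite
    integrals. *)
Lemma ae_le_integral d (Omega : measurableType d) (R : realType)
    (m : {measure set Omega -> \bar R}) (f g : Omega -> \bar R) :
  measurable_fun setT f -> measurable_fun setT g ->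
  {ae m, forall w, (f w <= g w)%E} ->
  (\int[m]_w f w <= \int[m]_w g w)%E.
Proof.
move=> mf mg fg; rewrite integralE [leRHS]integralE; apply: leeB.
  apply: ae_ge0_le_integral => //; [exact: measurable_funepos..|].
  apply: filterS fg => w fgw _.
  by rewrite !funeposE ge_max !le_max fgw lexx orbT.
apply: ae_ge0_le_integral => //; [exact: measurable_funeneg..|].
apply: filterS fg => w fgw _.
by rewrite !funenegE ge_max !le_max leeN2 fgw lexx orbT.
Qed.

Lemma bounded_Lfun2 d (Omega : measurableType d) (R : realType)
    (m : {finite_measure set Omega -> \bar R}) (f : Omega -> R) (C : R) :
  measurable_fun setT f -> (forall w, `|f w| <= C) -> f \in Lfun m 2%:E.
Proof.
move=> mf fC; rewrite inE; apply/andP; split; rewrite inE//=.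
rewrite /finite_norm unlock /Lnorm; apply: poweR_lty.
apply: (@le_lt_trans _ _ (\int[m]_w (C `^ 2)%:E)%E); last first.
  by rewrite integral_cst// ltey_eq fin_numM// fin_num_measure.
apply: ge0_le_integral => //.
- by move=> w _; rewrite lee_fin powR_ge0.
- apply/measurable_EFinP.
  apply: (@measurableT_comp _ _ _ _ _ _ (@powR R ^~ 2)) => //.
  exact: measurableT_comp.
- by move=> w _; rewrite lee_fin ge0_ler_powR// nnegrE (le_trans _ (fC w)).
Qed.

Lemma measurable_lagrangian_integrand d (U : measurableType d) (R : realType)
    (kappa alpha K w0 lambda eta : R) (Z M : U -> R) :
  measurable_fun setT Z -> measurable_fun setT M ->
  measurable_fun setT
    (fun u => lagrangian_integrand kappa alpha K w0 lambda eta (Z u) (M u)).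
Proof.
move=> mZ mM; rewrite /lagrangian_integrand /pos_part.
apply: measurable_funD; last first.
  apply: measurable_funM => //; apply: measurable_funB => //.
  exact: measurable_funM.
apply: measurable_funD; first exact: measurable_funN.
apply: measurable_funM => //; apply: measurable_funB => //.
apply: measurable_funD; first exact: measurable_funD.
apply: measurable_funM => //; apply: measurable_maxr => //.
by apply: measurable_funB => //; exact: measurable_funN.
Qed.

Theorem proposition2p2 (d : measure_display) (Omega : measurableType d)
    (R : realType) (P : probability Omega R)
    (n : nat) (n_gt0 : (0 < n)%N) (T : R) (T_gt0 : 0 < T)
    (W : R -> Omega -> 'cV[R]_n) (W_bm : brownian_motion P T W)
    (r : R -> Omega -> R) (mu : R -> Omega -> 'cV[R]_n)
    (sigma : R -> Omega -> 'M[R]_n)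
    (S0 : R -> Omega -> R) (S : 'I_n -> R -> Omega -> R)
    (mkt : market P T W r mu sigma S0 S)
    (I : 'I_n -> R -> Omega -> R)
    (I_ito : risk_integrals P T W r mu sigma I)
    (kappa B alpha K w0 lambda eta : R)
    (kappa_gt : 2^-1 < kappa) (kappa_lt : kappa < 1)
    (B_gt0 : 0 < B) (alpha_ge : - B <= alpha) (alpha_le : alpha <= 0)
    (w0_gt0 : 0 < w0) (lambda_ge0 : 0 <= lambda) (eta_gt0 : 0 < eta) :
  let Z := state_price_density r mu sigma I T in
  is_minimizer
    (admissible_payoff P (completed_natural_filtration P W T) B)
    (lagrangian P kappa alpha K w0 lambda eta Z)
    (fun w => optimal_payoff kappa B alpha lambda eta (Z w)).
Proof.
move=> Z; set G := completed_natural_filtration P W T.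
have GA : is_subalgebra G.
  exact: (completed_filtration_subalgebra (bm_measurable W_bm)).
have mZ : submeasurable G Z.
  apply: (state_price_density_submeasurable (ltW T_gt0) W_bm) => //.
  - exact: mk_r_predictable mkt.
  - exact: mk_mu_measurable mkt.
  - exact: mk_mu_adapted mkt.
  - exact: mk_sigma_measurable mkt.
  - exact: mk_sigma_adapted mkt.
pose M w := optimal_payoff kappa B alpha lambda eta (Z w).
have mM : submeasurable G M.
  exact: (measurableT_comp (measurable_optimal_payoff _ _ _ _ _) mZ).
have M_itv w : 0 <= M w <= B by exact: optimal_payoff_itv.
split.
  split => //; last exact: aeW.
  apply: (bounded_Lfun2 P (C := B) (measurable_fun_subalgebra GA mM)) => w.
  by have /andP[M0 MB] := M_itv w; rewrite ger0_norm.
move=> M' [mM' _ M'_itv]; rewrite /lagrangian unlock.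
apply: ae_le_integral.
- by apply/measurable_EFinP/measurable_lagrangian_integrand;
    apply: (measurable_fun_subalgebra GA).
- by apply/measurable_EFinP/measurable_lagrangian_integrand;
    apply: (measurable_fun_subalgebra GA).
apply: filterS M'_itv => w M'w; rewrite lee_fin.
exact: optimal_payoff_minimizes.
Qed.
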